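(* Let $(X,r)$ be an indecomposable solution whose permutation group $\mathcal{G}(X,r)$ is a cyclic group of prime power order $p^k$. Let $d$ be the Dehornoy's class of $(X,r)$ and let $mpl(X,r)$ be its multipermutation level. Then $d=|X|$ if $(|X|,mpl(X,r))\neq(4,2)$, and $d=2$ otherwise.
   Context: A solution is a pair $(X,r)$ with $X$ a non-empty set and $r:X\times X\to X\times X$, $r(x,y)=(\sigma_x(y),\tau_y(x))$, such that $(r\times \mathrm{id})(\mathrm{id}\times r)(r\times \mathrm{id})=(\mathrm{id}\times r)(r\times \mathrm{id})(\mathrm{id}\times r)$ on $X^3$, $r^2=\mathrm{id}$ (involutive), and all maps $\sigma_x,\tau_y:X\to X$ are bijections (non-degenerate). The permutation group $\mathcal{G}(X,r)$ is the subgroup of $\mathrm{Sym}(X)$ generated by all $\sigma_x$. $(X,r)$ is indecomposable if $\mathcal{G}(X,r)$ acts transitively on $X$. Retraction: define $x\sim_r y$ iff $\sigma_x=\sigma_y$. The solution $r$ induces canonically a solution on $X/\!\sim_r$ (by $([x],[y])\mapsto([\sigma_x(y)],[\tau_y(x)])$), denoted $\mathrm{Ret}(X,r)$; $\mathrm{Ret}^n$ denotes its $n$-th iterate, with $\mathrm{Ret}^0(X,r)=(X,r)$. The multipermutation level $mpl(X,r)$ is the minimal non-negative integer $n$ such that $\mathrm{Ret}^n(X,r)$ has cardinality one (if such $n$ exists). Dehornoy's class: set $x\cdot y=\sigma_x^{-1}(y)$ and define $\Omega_n:X^n\to X$ by $\Omega_1(x_1)=x_1$ and $\Omega_n(x_1,\dots,x_n)=\Omega_{n-1}(x_1,\dots,x_{n-1})\cdot\Omega_{n-1}(x_1,\dots,x_{n-2},x_n)$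 for $n>1$. The Dehornoy's class of $(X,r)$ is the minimal positive integer $d$ such that $\Omega_{d+1}(x,x,\dots,x,y)=y$ for all $x,y\in X$. *)

(* Defs.v *)
From mathcomp Require Import all_boot.
From mathcomp Require Import boolp classical_sets functions cardinality.

Set Implicit Arguments.
Unset Strict Implicit.
Unset Printing Implicit Defensive.

Local Open Scope classical_set_scope.
Local Open Scope card_scope.
Local Open Scope quotient_scope.

Section BraidMaps.
Variable X : Type.
Implicit Type r : X * X -> X * X.

Definition r_id r (t : X * X * X) : X * X * X :=
  (r (t.1.1, t.1.2), t.2).

Definition id_r r (t : X * X * X) : X * X * X :=
  let u := r (t.1.2, t.2) in (t.1.1, u.1, u.2).

Definition braid_equation r :=
  forall t, r_id r (id_r r (r_id r t)) = id_r r (r_id r (id_r r t)).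

End BraidMaps.

Record solution := Solution {
  carrier :> Type;
  sol_map : carrier * carrier -> carrier * carrier;
  sol_inhabited : inhabited carrier;
  sol_braid : braid_equation sol_map;
  sol_involutive : involutive sol_map;
  sol_bij_left : forall x, bijective (fun y => (sol_map (x, y)).1);
  sol_bij_right : forall y, bijective (fun x => (sol_map (x, y)).2) }.

Definition sigma (S : solution) (x y : S) : S := (sol_map (x, y)).1.
Definition tau (S : solution) (y x : S) : S := (sol_map (x, y)).2.

Section SolutionTheory.
Variable S : solution.
Implicit Types x y z a b : S.

Lemma sol_mapE x y : sol_map (x, y) = (sigma x y, tau y x).
Proof. by rewrite /sigma /tau; case: sol_map. Qed.

Lemma sigma_bij x : bijective (sigma x).
Proof. exact: sol_bij_left. Qed.

Lemma tau_bij y : bijective (tau y).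
Proof. exact: sol_bij_right. Qed.

Lemma sigma_inj x : injective (sigma x).
Proof. exact: bij_inj (sigma_bij x). Qed.

Lemma tau_inj y : injective (tau y).
Proof. exact: bij_inj (tau_bij y). Qed.

Lemma sigma_surj x y : exists z, sigma x z = y.
Proof. by case: (sigma_bij x) => g _ gK; exists (g y). Qed.

Lemma tau_surj y x : exists z, tau y z = x.
Proof. by case: (tau_bij y) => g _ gK; exists (g x). Qed.

Lemma braid_sigma x y z :
  sigma x (sigma y z) = sigma (sigma x y) (sigma (tau y x) z).
Proof.
have := congr1 (fun t => t.1.1) (@sol_braid S (x, y, z)).
by rewrite /r_id /id_r /= !sol_mapE /= ?sol_mapE.
Qed.

Lemma braid_tau x y z :
  tau z (tau y x) = tau (tau z y) (tau (sigma y z) x).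
Proof.
have := congr1 (fun t => t.2) (@sol_braid S (x, y, z)).
by rewrite /r_id /id_r /= !sol_mapE /= ?sol_mapE.
Qed.

Lemma sigma_sigma_tau x y : sigma (sigma x y) (tau y x) = x.
Proof.
by have := congr1 fst (@sol_involutive S (x, y)); rewrite !sol_mapE.
Qed.

Lemma tau_tau_sigma x y : tau (tau y x) (sigma x y) = y.
Proof.
by have := congr1 snd (@sol_involutive S (x, y)); rewrite !sol_mapE.
Qed.

Definition dot x y : S := sval (cid (sigma_surj x y)).

Lemma dotK x : cancel (dot x) (sigma x).
Proof. by move=> y; rewrite /dot; case: cid. Qed.

Lemma sigmaK x : cancel (sigma x) (dot x).
Proof. by move=> y; apply: (@sigma_inj x); rewrite dotK. Qed.

Lemma tau_dot x y : tau y x = dot (sigma x y) x.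
Proof. by apply: (@sigma_inj (sigma x y)); rewrite sigma_sigma_tau dotK. Qed.

Lemma sigma_dot x y z :
  sigma x (sigma (dot x y) z) = sigma y (sigma (dot y x) z).
Proof. by rewrite braid_sigma tau_dot !dotK. Qed.

Lemma dot_dot x y z : dot (dot x y) (dot x z) = dot (dot y x) (dot y z).
Proof.
apply: (@sigma_inj (dot x y)); apply: (@sigma_inj x).
by rewrite [in RHS]sigma_dot !dotK.
Qed.

Lemma dot_diag_tau a y : dot a (dot y y) = dot (tau a y) (tau a y).
Proof. by rewrite tau_dot dot_dot sigmaK. Qed.

Lemma tau_dot_diag y : tau (dot y y) y = dot y y.
Proof. by rewrite tau_dot dotK. Qed.

Lemma dot_diag_inj : injective (fun y => dot y y).
Proof.
move=> y y' /= e; apply: (@tau_inj (dot y y)).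
by rewrite tau_dot_diag {1}e [in RHS]e tau_dot_diag.
Qed.

Lemma dot_diag_surj y : exists z, dot z z = y.
Proof.
have [z zy] := tau_surj y y; exists z.
have e : tau y (sigma z y) = y by have := tau_tau_sigma z y; rewrite zy.
have {}e : sigma z y = z by apply: (@tau_inj y); rewrite e zy.
by rewrite -{2}e sigmaK.
Qed.

Lemma sigma_tau_eq a b : sigma a = sigma b <-> tau a = tau b.
Proof.
split=> e.
  have ed z : dot a z = dot b z.
    by apply: (@sigma_inj a); rewrite {2}e !dotK.
  by apply: funext => y; apply: dot_diag_inj; rewrite -!dot_diag_tau.
have ed z : dot a z = dot b z.
  by have [y <-] := dot_diag_surj z; rewrite !dot_diag_tau e.
by apply: funext => z; rewrite -[LHS](dotK b) -ed sigmaK.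
Qed.

Lemma sigma_congr x y y' :
  sigma y = sigma y' <-> sigma (sigma x y) = sigma (sigma x y').
Proof.
split=> e.
  have et : tau y x = tau y' x by rewrite (sigma_tau_eq y y').1.
  apply: funext => z; have [w <-] := sigma_surj (tau y x) z.
  by rewrite -braid_sigma et -braid_sigma e.
have et : tau y x = tau y' x.
  by apply: (@sigma_inj (sigma x y)); rewrite {2}e !sigma_sigma_tau.
by apply: funext => z; apply: (@sigma_inj x); rewrite braid_sigma e et -braid_sigma.
Qed.

Lemma tau_congr y x x' :
  sigma x = sigma x' <-> sigma (tau y x) = sigma (tau y x').
Proof.
rewrite !sigma_tau_eq; split=> e.
  have es : sigma x y = sigma x' y by rewrite (sigma_tau_eq x x').2.
  apply: funext => z; have [w <-] := tau_surj (sigma x y) z.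
  by rewrite -braid_tau es -braid_tau e.
have es : sigma x y = sigma x' y.
  by apply: (@tau_inj (tau y x)); rewrite {2}e !tau_tau_sigma.
by apply: funext => z; apply: (@tau_inj y); rewrite braid_tau e es -braid_tau.
Qed.

End SolutionTheory.

Section Retraction.
Variable S : solution.

Definition ret_rel (x y : {classic S}) : bool := `[< @sigma S x = @sigma S y >].

Lemma ret_rel_equiv : equiv_class_of ret_rel.
Proof.
split=> [x|x y|y x z].
- exact/asboolP.
- by apply/asboolP/asboolP => ->.
- by move=> /asboolP xy /asboolP yz; apply/asboolP; rewrite xy.
Qed.

Canonical ret_equiv := EquivRelPack ret_rel_equiv.

Definition ret_carrier : Type := {eq_quot ret_equiv}.

Definition ret_class (x : S) : ret_carrier := \pi_{eq_quot ret_equiv} x.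

Definition ret_repr (u : ret_carrier) : S := repr (u : {eq_quot ret_equiv}).

Lemma ret_reprK : cancel ret_repr ret_class.
Proof. exact: reprK. Qed.

Lemma ret_classP (x y : S) : ret_class x = ret_class y <-> sigma x = sigma y.
Proof. by split=> [/eqmodP/asboolP//|e]; apply/eqmodP/asboolP. Qed.

Lemma sigma_ret_repr (x : S) : sigma (ret_repr (ret_class x)) = sigma x.
Proof. by apply/ret_classP; rewrite ret_reprK. Qed.

(* The induced map, computed on representatives; ret_mapE shows that the
   choice of representatives is irrelevant. *)
Definition ret_map (p : ret_carrier * ret_carrier) :
    ret_carrier * ret_carrier :=
  let q := sol_map (ret_repr p.1, ret_repr p.2) in
  (ret_class q.1, ret_class q.2).

Lemma ret_mapE (x y : S) :
  ret_map (ret_class x, ret_class y) =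
  (ret_class (sigma x y), ret_class (tau y x)).
Proof.
rewrite /ret_map /= sol_mapE /=; congr pair; apply/ret_classP.
  rewrite sigma_ret_repr.
  by apply: (iffLR (sigma_congr _ _ _)); exact: sigma_ret_repr.
have /sigma_tau_eq -> := sigma_ret_repr y.
by apply: (iffLR (tau_congr _ _ _)); exact: sigma_ret_repr.
Qed.

Lemma ret_class_surj (u : ret_carrier) : exists x, u = ret_class x.
Proof. by exists (ret_repr u); rewrite ret_reprK. Qed.

Lemma ret_inhabited : inhabited ret_carrier.
Proof. by case: (sol_inhabited S) => x; split; exact: ret_class x. Qed.

Lemma ret_braid : braid_equation ret_map.
Proof.
move=> [[u v] w].
have [x ->] := ret_class_surj u.
have [y ->] := ret_class_surj v.
have [z ->] := ret_class_surj w.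
pose c (t : S * S * S) := (ret_class t.1.1, ret_class t.1.2, ret_class t.2).
have rc t : r_id ret_map (c t) = c (r_id (@sol_map S) t).
  by case: t => -[a b] d; rewrite /r_id /c ret_mapE sol_mapE.
have cr t : id_r ret_map (c t) = c (id_r (@sol_map S) t).
  by case: t => -[a b] d; rewrite /id_r /c ret_mapE sol_mapE.
have -> : (ret_class x, ret_class y, ret_class z) = c (x, y, z) by [].
by rewrite !(rc, cr) sol_braid.
Qed.

Lemma ret_involutive : involutive ret_map.
Proof.
move=> [u v].
have [x ->] := ret_class_surj u.
have [y ->] := ret_class_surj v.
by rewrite !ret_mapE sigma_sigma_tau tau_tau_sigma.
Qed.

Lemma inj_surj_bij (A B : Type) (f : A -> B) :
  injective f -> (forall b, exists a, f a = b) -> bijective f.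
Proof.
move=> fI fS; exists (fun b => sval (cid (fS b))) => [a|b]; last by case: cid.
by apply: fI; case: cid.
Qed.

Lemma ret_bij_left u : bijective (fun v => (ret_map (u, v)).1).
Proof.
have [x ->] := ret_class_surj u; apply: inj_surj_bij => [v v'|v].
  have [y ->] := ret_class_surj v; have [y' ->] := ret_class_surj v'.
  rewrite !ret_mapE /= => /ret_classP e; apply/ret_classP.
  exact: (iffRL (sigma_congr x _ _) e).
have [y ->] := ret_class_surj v; have [z <-] := sigma_surj x y.
by exists (ret_class z); rewrite ret_mapE.
Qed.

Lemma ret_bij_right v : bijective (fun u => (ret_map (u, v)).2).
Proof.
have [y ->] := ret_class_surj v; apply: inj_surj_bij => [u u'|u].
  have [x ->] := ret_class_surj u; have [x' ->] := ret_class_surj u'.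
  rewrite !ret_mapE /= => /ret_classP e; apply/ret_classP.
  exact: (iffRL (tau_congr y _ _) e).
have [x ->] := ret_class_surj u; have [z <-] := tau_surj y x.
by exists (ret_class z); rewrite ret_mapE.
Qed.

Definition Ret : solution :=
  Solution ret_inhabited ret_braid ret_involutive ret_bij_left ret_bij_right.

End Retraction.

Section PermutationGroup.
Variable X : Type.
Implicit Types H A : set (X -> X).

(* A subgroup of Sym(X), as a set of bijective self-maps of X *)
Definition is_perm_subgroup H : Prop :=
  [/\ forall f, H f -> bijective f,
      H idfun,
      forall f g, H f -> H g -> H (f \o g) &
      forall f g, H f -> cancel f g -> cancel g f -> H g].

Definition perm_generated A : set (X -> X) := smallest is_perm_subgroup A.

Definition perm_cyclic H : Prop := exists2 g, H g & H = perm_generated [set g].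

Lemma perm_generated_subgroup A :
  (forall f, A f -> bijective f) -> is_perm_subgroup (perm_generated A).
Proof.
move=> Abij; split.
- move=> f; apply; split; last exact: Abij.
  split=> [//||g h gb hb|g h _ gh hg].
  + by exists idfun.
  + exact: bij_comp.
  + by exists g.
- by move=> H [[_ H1 _ _] _].
- move=> f g Hf Hg H HA; have [[_ _ HM _] _] := HA.
  by apply: HM; [exact: Hf | exact: Hg].
- move=> f g Hf fg gf H HA; have [[_ _ _ HV] _] := HA.
  by apply: (HV f) => //; exact: Hf.
Qed.

End PermutationGroup.

Definition permutation_group (S : solution) : set (S -> S) :=
  perm_generated (range (@sigma S)).

Arguments permutation_group S _ : clear implicits.

Lemma permutation_group_subgroup (S : solution) :
  is_perm_subgroup (permutation_group S).
Proof.
by apply: perm_generated_subgroup => _ [x _ <-]; exact: sigma_bij.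
Qed.

Definition indecomposable (S : solution) : Prop :=
  forall x y : S, exists2 g, permutation_group S g & g x = y.

Definition is_mpl (S : solution) (n : nat) : Prop :=
  [set: iter n Ret S] #= `I_1 /\
  forall m, [set: iter m Ret S] #= `I_1 -> n <= m.

(* Omega_(n+1)(x_1, ..., x_n, y) is Omega [:: x_1; ...; x_n] y. *)
Fixpoint Omega_rev (S : solution) (s : seq S) (y : S) : S :=
  if s is x :: s' then dot (Omega_rev s' x) (Omega_rev s' y) else y.

Definition Omega (S : solution) (s : seq S) (y : S) : S := Omega_rev (rev s) y.

Lemma Omega_nil (S : solution) (y : S) : Omega [::] y = y.
Proof. by []. Qed.

Lemma Omega_rcons (S : solution) (s : seq S) (x y : S) :
  Omega (rcons s x) y = dot (Omega s x) (Omega s y).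
Proof. by rewrite /Omega rev_rcons. Qed.

Definition Omega_trivial (S : solution) (d : nat) : Prop :=
  forall x y : S, Omega (nseq d x) y = y.

Definition is_dehornoy_class (S : solution) (d : nat) : Prop :=
  [/\ 0 < d, Omega_trivial S d &
      forall e, 0 < e -> Omega_trivial S e -> d <= e].

(* Main.v *)
Require Import Defs.
From mathcomp Require Import all_boot all_order all_algebra all_fingroup.
From mathcomp Require Import all_solvable.
From mathcomp Require Import boolp classical_sets functions cardinality.
From mathcomp Require Import fintype finset.

(** Why the theorem holds.

    The group of the solution is abelian and transitive on S, hence regular.
    A generator of it therefore identifies S with U = Z/N, where N = p^k, in
    such a way that each sigma_x is a translation v |-> v + f x, where the
    values of f generate U ([cyclic_coordinates]).  In these coordinates the
    cycle-set identity of the operation x . y reads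
      f x + f (y - f x) = f y + f (x - f y),
    and with T x = x - f x the sum defining Omega telescopes:
      Omega_(e+1) (u, ..., u, v) = v - u + T^e u   ([Omega_phi]).
    So the Dehornoy class is the order of the permutation T of U.

    The identity above says precisely that the permutations
    P_z v = v + f (z - v) of U commute with each other.  Translating by u
    conjugates P_z into P_(z+u), and x |-> -x conjugates P_0 into T.  The
    group A generated by the P_z (the additive group of the brace of S) is thus
    abelian, normalised by the translations, and transitive because the values
    P_z 0 = f z generate U.  Hence A is regular of order N,
    its generators all have the order of T, and T has order N exactly when A
    is cyclic ([iter_card_diag], [card_dvd_diag_order]).

    It remains to see that a regular abelian group A normalised by the
    translations of a cyclic p-group U is cyclic unless N = 4
    ([regular_abelian_cyclic]).  In the p-group G spanned by A and the
    translations, a noncyclic A with #|A| != 4 contains a normal subgroup V of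
    G such that (h v)^q = h^q for all h in G and v in V, for some
    q < #|V| ([noncyclic_normal_section]): V is elementary abelian of order
    p^2 and q = p if p is odd, and V has order 8 and q = 4 if p = 2.  But the
    V-orbit of 0 is a subgroup of U of order #|V|, generated by some t; the
    translation by t is a product h v where h fixes 0 and v is in V, so its
    q-th power h^q fixes 0 and t would have order at most q.

    For N = 4 a finite check shows that either f is constant, in which case T
    is a translation of order 4 and Ret S is trivial, or T has order 2 and S
    has multipermutation level 2 ([order4_nonconst], [is_mpl2]). *)

Set Implicit Arguments.
Unset Strict Implicit.
Unset Printing Implicit Defensive.

Import GRing.Theory FinRing.Theory.

(** * Power identities in normal subgroups of p-groups *)

Section NormalSubgroupsOfPGroups.

Local Open Scope group_scope.

Variable gT : finGroupType.
Implicit Types (p : nat) (A G V W : {group gT}).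

(** Commuting with a nilpotent group strictly shrinks a nontrivial normal
    subgroup, and here there is room for only two strict steps. *)
Lemma comm2_normal_p2 p G W :
  prime p -> p.-group G -> W <| G -> #|W| = (p ^ 2)%N -> [~: W, G, G] = 1.
Proof.
move=> p_pr pG nsWG oW.
have ppos := prime_gt1 p_pr.
have drop (H : {group gT}) i : H <| G -> #|H| = (p ^ i.+1)%N ->
    exists2 j, j <= i & #|[~: H, G]| = (p ^ j)%N.
  move=> /andP[sHG nHG] oH.
  have ntH : H :!=: 1 by rewrite -cardG_gt1 oH (ltn_exp2l 0).
  have ltHG : [~: H, G] \proper H.
    by apply: (nil_comm_properl (pgroup_nil pG) sHG ntH); rewrite subsetI subxx.
  have := cardSg (proper_sub ltHG); rewrite oH.
  case/(dvdn_pfactor _ _ p_pr)=> j _ oj.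
  by exists j; rewrite // -ltnS -(ltn_exp2l _ _ ppos) -oj -oH proper_card.
have triv (H : {group gT}) : #|H| = (p ^ 0)%N -> H :=: 1.
  by move=> oH; apply/eqP; rewrite trivg_card1 oH.
have [[|[|//]] _ oC] := drop W 1%N nsWG oW.
  by rewrite (triv [~: W, G]%G oC) comm1G.
have nsCG : [~: W, G] <| G.
  by rewrite /normal commg_normr (subset_trans _ (normal_sub nsWG)) //
             commg_subl normal_norm.
have [[|//] _ oCC] := drop [~: W, G]%G 0%N nsCG oC.
exact: (triv [~: W, G, G]%G oCC).
Qed.

Lemma commute_comm_normal_p2 p G W h w :
  prime p -> p.-group G -> W <| G -> #|W| = (p ^ 2)%N -> h \in G -> w \in W ->
  commute h [~ w, h].
Proof.
move=> p_pr pG nsWG oW Gh Ww; apply/commute_sym/commgP/eqP/set1gP.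
by rewrite -(comm2_normal_p2 p_pr pG nsWG oW) !mem_commg.
Qed.

(** Since [v, h] commutes with h and with v, the power expands as
    h^p v^p [v, h]^'C(p, 2), and p divides 'C(p, 2) as p is odd. *)
Lemma expg_mul_abelem p G W h v :
  prime p -> odd p -> p.-group G -> W <| G -> p.-abelem W ->
  #|W| = (p ^ 2)%N -> h \in G -> v \in W -> (h * v) ^+ p = h ^+ p.
Proof.
move=> p_pr p_odd pG nsWG /(abelemP p_pr)[cWW W1] oW Gh Wv.
have Wc : [~ v, h] \in W.
  by rewrite groupMl ?groupV // memJ_norm // (subsetP (normal_norm nsWG)).
have ch := commute_comm_normal_p2 p_pr pG nsWG oW Gh Wv.
have cv : commute v [~ v, h] by exact: (centsP cWW).
have /dvdnP[b eb] : p %| 'C(p, 2).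
  by apply: prime_dvd_bin; rewrite //= odd_prime_gt2.
rewrite (expMg_Rmul _ cv ch) eb (W1 v) // mulg1.
by rewrite mulnC expgM (W1 _ Wc) expg1n mulg1.
Qed.

(** For p = 2 the factor [v, h]^'C(2, 2) survives in the square, which only
    shows that (h v)^2 = h^2 w with w in W.  Squaring once more kills it:
    w^2 = 1, and w commutes with h^2 because [w, h^2] = [w, h]^2 = 1. *)
Lemma expg4_mul_comm G V W h v :
  2.-group G -> W <| G -> 2.-abelem W -> #|W| = 4 -> [~: V, G] \subset W ->
  h \in G -> v \in V -> v ^+ 2 \in W -> v \in G -> (h * v) ^+ 4 = h ^+ 4.
Proof.
move=> pG nsWG abW oW sVGW Gh Vv Wv2 Gv.
have /(abelemP (isT : prime 2))[_ W1] := abW.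
pose w := v ^ h * v.
have Ww : w \in W.
  have ->: w = v ^+ 2 * [~ v, h] ^ v.
    by rewrite /w conjg_mulR conjgE expgS expg1 !mulgA mulgK.
  rewrite groupM // memJ_norm ?(subsetP (normal_norm nsWG)) //.
  by rewrite (subsetP sVGW) ?mem_commg.
have -> : (h * v) ^+ 4 = (h ^+ 2 * w) ^+ 2.
  rewrite (expgM _ 2 2); congr (_ ^+ 2).
  by rewrite /w conjgE !expgS !expg0 !mulg1 !mulgA mulgK.
have ch := @commute_comm_normal_p2 2 G W h w isT pG nsWG oW Gh Ww.
have /commgP cw : [~ w, h ^+ 2] == 1.
  rewrite commgX // W1 // groupMl ?groupV // memJ_norm //.
  by rewrite (subsetP (normal_norm nsWG)).
by rewrite expgMn // (W1 w) // mulg1 -expgM.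
Qed.

(** V is the preimage of a subgroup of order p in A / W that is normal, hence
    central, in the p-group G / W. *)
Lemma exists_central_step p G A W :
  prime p -> p.-group G -> A <| G -> W <| G -> W \proper A ->
  exists V : {group gT}, [/\ V \subset A, V <| G, #|V| = (p * #|W|)%N,
    [~: V, G] \subset W & {in V, forall v, v ^+ p \in W}].
Proof.
move=> p_pr pG nsAG nsWG ltWA.
have sWA := proper_sub ltWA.
have nsWA := normalS sWA (normal_sub nsAG) nsWG.
have pGW : p.-group (G / W) by exact: quotient_pgroup.
have pA := pgroupS (quotientS W (normal_sub nsAG)) pGW.
have nsAGW := quotient_normal W nsAG.
have [|Q [sQA nsQG oQ]] := @normal_pgroup p _ 1 _ _ pGW nsAGW.
  rewrite lt0n; apply: contraTneq (proper_subn ltWA) => l0.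
  have: #|A / W| = 1%N by rewrite (card_pgroup pA) l0.
  by move/eqP; rewrite -trivg_card1 -subG1 quotient_sub1 ?normal_norm // negbK.
have cQ : Q \subset 'Z(G / W).
  apply: prime_meetG; first by rewrite oQ expn1.
  apply: (meet_center_nil (pgroup_nil pGW) nsQG).
  by rewrite -cardG_gt1 oQ expn1 prime_gt1.
have [V defQ sWV nsVG] := inv_quotientN nsWG nsQG.
have nWG := normal_norm nsWG; have nWV := subset_trans (normal_sub nsVG) nWG.
have oV : #|V| = (p * #|W|)%N.
  by rewrite -(Lagrange sWV) -card_quotient // -defQ oQ expn1 mulnC.
exists V; split=> //.
- rewrite -(quotientSGK nWV sWA) -defQ //.
- by rewrite -quotient_cents2 // -defQ (subset_trans cQ) ?subsetIr.
move=> v Vv; have nWv := subsetP nWV _ Vv.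
apply: coset_idr; rewrite ?groupX // morphX //.
have Qv : coset W v \in Q by rewrite defQ mem_quotient.
by have := expg_cardG Qv; rewrite oQ.
Qed.

(** A noncyclic A has an elementary abelian 'Ohm_1(A) of order at least p^2,
    in which a normal subgroup W of G of order p^2 can be found.  It serves as
    V when p is odd; when p = 2 it has to be enlarged to order 8, which is
    where #|A| != 4 enters. *)
Lemma noncyclic_normal_section p G A :
  prime p -> p.-group G -> A <| G -> abelian A -> ~~ cyclic A -> #|A| != 4 ->
  exists (V : {group gT}) (q : nat),
    [/\ V \subset A, V <| G, 0 < q < #|V| &
        {in G & V, forall h v, (h * v) ^+ q = h ^+ q}].
Proof.
move=> p_pr pG nsAG cAA ncA oA4.
have pA := pgroupS (normal_sub nsAG) pG.
have abO := Ohm1_abelem pA cAA.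
have nsOG : 'Ohm_1(A) <| G := gFnormal_trans _ nsAG.
have [|W [sWO nsWG oW]] := @normal_pgroup p _ 2 _ _ pG nsOG.
  by rewrite -p_rank_abelian // -(rank_pgroup pA) ltnNge -abelian_rank1_cyclic.
have sWA := subset_trans sWO (Ohm_sub 1 A).
have abW := abelemS sWO abO.
have [p2 | p_odd] := even_prime p_pr; last first.
  exists W, p; split=> // [|h v Gh Wv].
    by rewrite oW prime_gt0 //= -{1}(expn1 p) ltn_exp2l ?prime_gt1.
  exact: expg_mul_abelem nsWG abW oW Gh Wv.
move: pG abW; rewrite p2 in oW * => pG abW.
have ltWA : W \proper A.
  by rewrite properEcard sWA ltn_neqAle oW eq_sym oA4 -oW subset_leq_card.
have [V [sVA nsVG oV sVGW Vp]] :=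
  @exists_central_step 2 G A W isT pG nsAG nsWG ltWA.
exists V, 4; split=> // [|h v Gh Vv]; first by rewrite oV oW.
have Gv := subsetP (normal_sub nsVG) v Vv.
exact: expg4_mul_comm pG nsWG abW oW sVGW Gh Vv (Vp v Vv) Gv.
Qed.

End NormalSubgroupsOfPGroups.

(** * Regular abelian groups normalised by the translations *)

Section RegularAbelian.

Local Open Scope group_scope.

Variable U : finZmodType.
Implicit Types (u v x : U) (A : {group {perm U}}).

Definition translation u : {perm U} := perm (@addIr U u).

Lemma translationE u x : translation u x = (x + u)%R.
Proof. exact: permE. Qed.

Lemma translationM : {in [set: U] &, {morph translation : u v / u * v}}.
Proof.
by move=> u v _ _; apply/permP=> x; rewrite permM !translationE zmodMgE addrA.
Qed.

Canonical translation_morphism := Morphism translationM.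

Lemma abelian_trans_inj A x :
  abelian A -> [transitive A, on [set: U] | 'P] ->
  {in A &, injective (fun a : {perm U} => a x)}.
Proof.
move=> cAA trA a b Aa Ab /= ab; apply/permP=> y.
have /imsetP[c Ac ->] : y \in orbit 'P A x by rewrite (atransP trA) ?inE.
have cc := centsP cAA c Ac.
by rewrite /= apermE -!permM (cc a Aa) (cc b Ab) !permM ab.
Qed.

Lemma card_abelian_trans A :
  abelian A -> [transitive A, on [set: U] | 'P] -> #|A| = #|U|.
Proof.
move=> cAA trA; rewrite -cardsT -(atransP trA 0%R) ?inE // /orbit.
rewrite card_in_imset //; exact: abelian_trans_inj.
Qed.

(** The orbit of 0 is closed under addition because a 0 + b 0 is the image of
    0 under a followed by the conjugate of b by the translation by a 0. *)
Lemma orbit0_group_set A :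
  (forall u, translation u \in 'N(A)) ->
  group_set [set a 0%R | a : {perm U} in A].
Proof.
move=> nA; apply/group_setP; split.
  by apply/imsetP; exists 1; rewrite ?perm1.
move=> _ _ /imsetP[a Aa ->] /imsetP[b Ab ->]; apply/imsetP.
exists (a * b ^ translation (a 0%R)); first by rewrite groupM // memJ_norm.
have a0E : a 0%R = translation (a 0%R) 0%R by rewrite translationE add0r.
by rewrite permM [RHS](congr1 _ a0E) permJ translationE zmodMgE addrC.
Qed.

(** If A were noncyclic, the V-orbit of 0, a cyclic subgroup of U of order #|V|,
    would have a generator of order at most q < #|V|. *)
Lemma regular_abelian_cyclic A p k :
    prime p -> #|U| = (p ^ k)%N -> #|U| != 4 -> cyclic [set: U] ->
    abelian A -> [transitive A, on [set: U] | 'P] ->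
    (forall u, translation u \in 'N(A)) ->
  cyclic A.
Proof.
move=> p_pr oU oU4 cycU cAA trA nA; apply: contraT => ncA.
have oA := card_abelian_trans cAA trA.
pose C := (translation @* [set: U])%G.
pose G := (A <*> C)%G.
have nAC : C \subset 'N(A).
  by apply/subsetP=> _ /morphimP[u _ _ ->]; exact: nA.
have pA : p.-group A by rewrite /pgroup oA oU pnatX pnat_id.
have pG : p.-group G.
  have pC : p.-group C.
    by rewrite morphim_pgroup // /pgroup cardsT oU pnatX pnat_id.
  by rewrite /= norm_joinEr // pgroupM pA.
have nsAG : A <| G by rewrite /normal joing_subl join_subG normG.
rewrite -oA in oU4.
have [V [q [sVA nsVG /andP[q0 ltqV] expq]]] :=
  noncyclic_normal_section p_pr pG nsAG cAA ncA oU4.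
have GC u : translation u \in G.
  by rewrite (subsetP (joing_subr A C)) ?mem_morphim ?inE.
pose D := [set v 0%R | v : {perm U} in V].
have gD : group_set D.
  by apply: orbit0_group_set => u; rewrite (subsetP (normal_norm nsVG)).
have oD : #|D| = #|V|.
  rewrite card_in_imset // => a b Va Vb.
  by apply: (abelian_trans_inj cAA trA); rewrite (subsetP sVA).
have /cyclicP[t defD] : cyclic (Group gD).
  by apply: cyclicS cycU; exact: subsetT.
have /imsetP[v Vv tv] : t \in D by rewrite -[D]/(gval (Group gD)) defD cycle_id.
pose h := translation t * v^-1.
have Gv := subsetP (normal_sub nsVG) v Vv.
have Gh : h \in G by rewrite groupM ?groupV.
have := expq h v Gh Vv; rewrite mulgKV -morphX ?inE //.
move/permP/(_ 0%R); rewrite translationE add0r.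
have -> : (h ^+ q) 0%R = 0%R.
  elim: (q) => [|m IH]; first by rewrite perm1.
  by rewrite expgSr permM IH permM translationE add0r tv permK.
move/eqP; rewrite -order_dvdn orderE -defD /= oD => /(dvdn_leq q0).
by rewrite leqNgt ltqV.
Qed.

End RegularAbelian.

(** * Cycle sets whose left multiplications are translations *)

Section CyclicCycleSet.

Local Open Scope group_scope.

Variables (U : finZmodType) (f : U -> U).
Hypothesis f_cycle : forall x y,
  (f x + f (y - f x) = f y + f (x - f y))%R.
Hypothesis f_gen : <<[set f x | x : U]>> = [set: U].

(** In coordinates, the diagonal x |-> x . x of the cycle set. *)
Definition diag (x : U) : U := (x - f x)%R.

Hypothesis diag_inj : injective diag.

Lemma displ_inj z : injective (fun v : U => z - diag (z - v))%R.
Proof. by move=> v w /= /subrI/diag_inj/subrI. Qed.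

(** The addition of f z in the brace of the solution, v |-> v + f (z - v),
    written as v |-> z - T (z - v) to exhibit it as a conjugate of T by the
    involution v |-> z - v. *)
Definition displ z : {perm U} := perm (@displ_inj z).

Lemma displE z v : displ z v = (v + f (z - v))%R.
Proof. by rewrite permE /diag opprB addrCA subKr addrC. Qed.

(** The cycle-set identity, applied to x - v and y - v. *)
Lemma displC x y : commute (displ x) (displ y).
Proof.
apply/permP=> v; rewrite !permM !displE -!addrA; congr (_ + _)%R.
by rewrite !opprD !addrA f_cycle.
Qed.

Lemma displJ z u : displ z ^ translation u = displ (z + u)%R.
Proof.
apply/permP=> v; rewrite -[v](subrK u) -translationE permJ.
rewrite !translationE !displE.
by rewrite addrAC subrK opprB addrA.
Qed.

Lemma displX z e v : (displ z ^+ e) v = (z - iter e diag (z - v))%R.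
Proof.
elim: e => [|e IH]; first by rewrite perm1 subKr.
by rewrite expgSr permM IH permE subKr.
Qed.

Definition displ_group := <<[set displ z | z : U]>>%G.

Lemma mem_displ z : displ z \in displ_group.
Proof. by rewrite mem_gen ?imset_f. Qed.

Lemma displ_abelian : abelian displ_group.
Proof.
rewrite abelian_gen; apply/centsP=> _ /imsetP[x _ ->] _ /imsetP[y _ ->].
exact: displC.
Qed.

Lemma displ_norm u : translation u \in 'N(displ_group).
Proof.
rewrite -sub1set norms_gen // sub1set inE.
apply/subsetP=> _ /imsetP[_ /imsetP[z _ ->] ->].
by rewrite displJ imset_f.
Qed.

Lemma displ_trans : [transitive displ_group, on [set: U] | 'P].
Proof.
apply/imsetP; exists 0%R => //; apply/esym/eqP.
rewrite eqEsubset subsetT -f_gen.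
rewrite (gen_subG _ (Group (orbit0_group_set displ_norm))).
apply/subsetP=> _ /imsetP[z _ ->]; apply/imsetP; exists (displ z) => //.
  exact: mem_displ.
by rewrite displE subr0 add0r.
Qed.

Lemma card_displ_group : #|displ_group| = #|U|.
Proof. exact: card_abelian_trans displ_abelian displ_trans. Qed.

(** The group of displacements has order #|U|, and the powers of displ 0 are
    those of T conjugated by the negation. *)
Lemma iter_card_diag x : iter #|U| diag x = x.
Proof.
have := displX 0%R #|U| (- x)%R; rewrite opprK !add0r.
by rewrite -{1}card_displ_group expg_cardG ?mem_displ // perm1 => /oppr_inj.
Qed.

(** If T^e = 1 then all generators of the abelian displacement group, hence
    all its elements, have order dividing e; this applies to a generator of
    that group, whose order is #|U|. *)
Lemma card_dvd_diag_order p k e :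
    prime p -> #|U| = (p ^ k)%N -> #|U| != 4 -> cyclic [set: U] ->
  iter e diag =1 id -> #|U| %| e.
Proof.
move=> p_pr oU oU4 cycU diag_e.
have /cyclicP[a defA] : cyclic displ_group.
  apply: regular_abelian_cyclic oU oU4 cycU displ_abelian displ_trans _ => //.
  exact: displ_norm.
have: displ_group \subset 'Ldiv_e(displ_group).
  rewrite (gen_subG _ (Group (group_Ldiv e displ_abelian))).
  apply/subsetP=> _ /imsetP[z _ ->]; rewrite !inE mem_displ /=.
  by apply/eqP/permP=> v; rewrite displX diag_e subKr perm1.
move/subsetP/(_ a); rewrite {1}defA cycle_id => /(_ isT).
by rewrite !inE => /andP[_]; rewrite -order_dvdn orderE -defA card_displ_group.
Qed.

End CyclicCycleSet.

(** * Coordinates on a solution with cyclic permutation group *)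

Section CyclicPermGroup.

Local Open Scope classical_set_scope.
Local Open Scope card_scope.

Lemma iter_comp (X : Type) (g : X -> X) i j :
  iter i g \o iter j g = iter (i + j) g.
Proof. by apply/funext => x; rewrite /= iterD. Qed.

Lemma iter_mod (X : Type) (g : X -> X) m i :
  iter m g = id -> iter i g = iter (i %% m) g.
Proof.
move=> gm; rewrite {1}(divn_eq i m) -iter_comp.
suff -> : iter (i %/ m * m) g = id by [].
by elim: (i %/ m) => // k IH; rewrite mulSn -iter_comp IH gm.
Qed.

(** The group H is given as the intersection of all subgroups of Sym(X) that
    contain a generator.  Being finite, it consists of the powers of that
    generator up to its order, which the cardinality identifies as N. *)
Lemma perm_cyclicP (X : Type) (H : set (X -> X)) N :
  is_perm_subgroup H -> perm_cyclic H -> H #= `I_N ->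
  exists g : X -> X,
    [/\ iter N g = id,
        forall i j, i < N -> j < N -> iter i g = iter j g -> i = j &
        forall h, H h <-> exists2 i, i < N & h = iter i g].
Proof.
move=> [Hbij H1 HM HV] [g Hg defH] cardH; exists g.
have Hpow i : H (iter i g).
  by elim: i => // i IH; rewrite -[i.+1]add1n -iter_comp; exact: HM.
have gI : injective g by exact: bij_inj (Hbij g Hg).
have iterI i : injective (iter i g) by elim: i => // i IH x y /gI/IH.
have [m m_gt0 gm] : exists2 m, 0 < m & iter m g = id.
  apply: contrapT => noper.
  suff powI : injective (fun i => iter i g).
    have /card_le_finite : [set: nat] #<= H.
      have /card_esym/card_eqPle[le1 _] :=
        inj_card_eq (in2W powI : {in [set: nat] &, _}).
      by apply: card_le_trans le1 _; apply: subset_card_le => _ [i _ <-].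
    by move=> /(_ (ex_intro _ N cardH)); exact: infinite_nat.
  have lt_pow i j : i < j -> iter i g = iter j g -> False.
    move=> ltij eij; apply: noper; exists (j - i); first by rewrite subn_gt0.
    apply/funext=> x; apply: (@iterI i).
    by rewrite -iterD subnKC 1?ltnW // -eij.
  by move=> i j eij; case: (ltngtP i j) => // /lt_pow; case.
have exm : exists m, (0 < m) && `[< iter m g = id >].
  by exists m; rewrite m_gt0; apply/asboolP.
case: (ex_minnP exm) => {m_gt0 gm exm}m /andP[m_gt0 /asboolP gm] min_m.
have powI i j : i < m -> j < m -> iter i g = iter j g -> i = j.
  wlog lij : i j / i <= j.
    by move=> W ? ? e; case/orP: (leq_total i j) => l; [|symmetry]; exact: W.
  move=> im jm eij; apply/eqP; rewrite eqn_leq lij leqNgt; apply/negP=> ltij.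
  have: m <= j - i.
    apply: min_m; rewrite subn_gt0 ltij; apply/asboolP/funext=> x.
    by apply: (@iterI i); rewrite -iterD subnKC // -eij.
  by rewrite leqNgt (leq_ltn_trans (leq_subr _ _) jm).
have HP h : H h <-> exists2 i, i < m & h = iter i g.
  split=> [|[i _ ->]] //; rewrite [in X in X -> _]defH.
  move=> /(_ [set f | exists2 i, i < m & f = iter i g]).
  apply; split; last first.
    move=> _ ->; exists (1 %% m); first by rewrite ltn_mod.
    by rewrite -iter_mod.
  split=> [_ [i _ ->]||_ _ [i _ ->] [j _ ->]|_ k [i im ->] ck kc].
  - exact: Hbij.
  - by exists 0.
  - by exists ((i + j) %% m); rewrite ?ltn_mod // -iter_mod // iter_comp.
  exists ((m - i) %% m); first by rewrite ltn_mod.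
  rewrite -iter_mod //; apply/funext=> x; apply: (@iterI i).
  by rewrite kc -iterD subnKC 1?ltnW // gm.
suff -> : N = m by [].
apply: card_eq_II; apply: card_eq_trans (card_esym cardH) _.
have -> : H = (fun i => iter i g) @` `I_m.
  by apply/seteqP; split=> h; rewrite HP => -[i im]; exists i.
by apply: inj_card_eq => i j /set_mem im /set_mem jm; exact: powI.
Qed.

(** The coordinate of a point is the exponent of the generator g that carries
    a base point x0 to it.  Two powers of g that agree at x0 agree everywhere,
    because g commutes with the elements that move x0 around.  The powers of g
    with exponent in the group generated by the values of f form a subgroup of
    Sym(S) that contains every sigma, hence they exhaust the powers of g. *)
Lemma cyclic_coordinates (S : solution) n :
  indecomposable S -> perm_cyclic (permutation_group S) ->
  permutation_group S #= `I_n.+1 ->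
  exists (phi : 'I_n.+1 -> S) (f : 'I_n.+1 -> 'I_n.+1),
    [/\ bijective phi,
        forall u v, sigma (phi u) (phi v) = phi (v + f u)%R &
        <<[set f u | u : 'I_n.+1]%SET>>%g = [set: 'I_n.+1]%SET].
Proof.
move=> indS cycS cardS.
have [g [gN gI gP]] := perm_cyclicP (permutation_group_subgroup S) cycS cardS.
have [x0] := sol_inhabited S.
pose phi (u : 'I_n.+1) := iter u g x0.
have phiD (u v : 'I_n.+1) : iter u g (phi v) = phi (v + u)%R.
  by rewrite -iterD /phi (iter_mod _ gN) /= addnC.
have phi_surj x : exists u, phi u = x.
  have [h /gP[i iN ->] <-] := indS x0 x; by exists (Ordinal iN).
have phiI : injective phi.
  move=> u v uv; apply/val_inj/(gI _ _ (ltn_ord u) (ltn_ord v))/funext => x.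
  have [w <-] := phi_surj x; rewrite /phi -!iterD ![_ + w]addnC !iterD.
  by rewrite -![iter _ _ x0]/(phi _) uv.
have /choice[f fP] u : exists a : 'I_n.+1, sigma (phi u) = iter a g.
  have /gP[i iN ->] : permutation_group S (sigma (phi u)).
    by move=> H [_]; apply; exists (phi u).
  by exists (Ordinal iN).
exists phi, f; split.
- exact: inj_surj_bij.
- by move=> u v; rewrite fP phiD.
apply/setP=> u; rewrite [in RHS]inE.
pose K : set (S -> S) := fun h =>
  exists2 w, w \in <<[set f u | u : 'I_n.+1]%SET>>%g & h = iter w g.
have: K (iter u g).
  have: permutation_group S (iter u g) by apply/gP; exists u.
  move=> /(_ K); apply; split; last first.
    move=> _ [x _ <-]; have [w <-] := phi_surj x.
    by exists (f w); rewrite ?mem_gen ?imset_f.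
  have iterV (w : 'I_n.+1) : cancel (iter (- w)%R g) (iter w g).
    move=> x; rewrite -iterD (iter_mod _ gN).
    by rewrite -[_ %% _]/(nat_of_ord (w + - w)%R) GRing.subrr.
  have iterVK (w : 'I_n.+1) : cancel (iter w g) (iter (- w)%R g).
    by move=> x; have := iterV (- w)%R x; rewrite GRing.opprK.
  split=> [_ [w _ ->]||_ _ [w Kw ->] [v Kv ->]|_ k [w Kw ->] ck kc].
  - by exists (iter (- w)%R g).
  - by exists 0%R; rewrite // group1.
  - exists (w + v)%R; first exact: groupM.
    by rewrite iter_comp (iter_mod _ gN).
  exists (- w)%R; first by rewrite -FinRing.zmodVgE groupV.
  by apply/funext=> x; rewrite -{1}[x](iterV w) ck.
by case=> w Kw /(gI _ _ (ltn_ord u) (ltn_ord w))/val_inj ->.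
Qed.

End CyclicPermGroup.

Section SmallCardinals.
Local Open Scope classical_set_scope.
Local Open Scope card_scope.

Lemma card_setT1P (T : Type) :
  inhabited T -> [set: T] #= `I_1 <-> forall x y : T, x = y.
Proof.
move=> [x0]; split=> [/card_set_bijP[h [hfun hinj _]] x y|eqT].
  have h0 z : h z = 0 by case: (h z) (hfun z I).
  by apply: hinj; rewrite ?classical_sets.in_setT // !h0.
suff -> : [set: T] = [set x0] by exact: card_set1.
by apply/seteqP; split=> x.
Qed.

Lemma card_bijective (T : Type) n (phi : 'I_n -> T) :
  bijective phi -> [set: T] #= `I_n.
Proof.
move=> bphi; apply: card_esym; apply: card_eq_trans card_II _.
apply: card_esym; have -> : [set: T] = phi @` [set: 'I_n].
  apply/seteqP; split=> // x _; case: bphi => psi _ psiK.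
  by exists (psi x); rewrite // psiK.
by apply: inj_card_eq => i j _ _; exact: bij_inj.
Qed.

End SmallCardinals.

Lemma sigma_ret (S : solution) (x y : S) :
  @sigma (Ret S) (ret_class x) (ret_class y) = ret_class (sigma x y).
Proof. by rewrite -[LHS]/((ret_map (ret_class x, ret_class y)).1) ret_mapE. Qed.

Section Coordinates.

Variables (S : solution) (U : finZmodType) (phi : U -> S) (f : U -> U).
Hypothesis phi_bij : bijective phi.
Hypothesis sigma_phi : forall u v, sigma (phi u) (phi v) = phi (v + f u)%R.
Local Open Scope ring_scope.

Let phi_inj := bij_inj phi_bij.

Lemma phi_surj x : exists u, x = phi u.
Proof. by case: phi_bij => psi _ psiK; exists (psi x). Qed.

Lemma dot_phi u v : dot (phi u) (phi v) = phi (v - f u).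
Proof. by rewrite -{1}(subrK (f u) v) -sigma_phi sigmaK. Qed.

Lemma coord_cycle x y : f x + f (y - f x) = f y + f (x - f y).
Proof.
have := dot_dot (phi x) (phi y) (phi 0).
rewrite !dot_phi => /phi_inj; rewrite !sub0r -!opprD.
exact: oppr_inj.
Qed.

Lemma coord_diag_inj : injective (diag f).
Proof.
move=> u v uv; apply/phi_inj/dot_diag_inj.
by rewrite !dot_phi; congr phi.
Qed.

(** Each step subtracts f (T^i u) = T^i u - T^(i+1) u, so the sum telescopes. *)
Lemma Omega_phi e u v :
  Omega (nseq e (phi u)) (phi v) = phi (v - u + iter e (diag f) u).
Proof.
elim: e v => [|e IH] v; first by rewrite Omega_nil /= subrK.
have -> : nseq e.+1 (phi u) = rcons (nseq e (phi u)) (phi u).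
  by rewrite -cats1 cat_nseq /ncons -iterSr.
by rewrite Omega_rcons !IH dot_phi subrr add0r -addrA.
Qed.

Lemma Omega_trivialP e : Omega_trivial S e <-> iter e (diag f) =1 id.
Proof.
split=> [triv u|diag_e x y].
  by have := triv (phi u) (phi u); rewrite Omega_phi subrr add0r => /phi_inj.
have [u ->] := phi_surj x; have [v ->] := phi_surj y.
by rewrite Omega_phi diag_e subrK.
Qed.

Lemma sigma_phi_eq u v : sigma (phi u) = sigma (phi v) <-> f u = f v.
Proof.
split=> [/(congr1 (@^~ (phi 0)))|e].
  by rewrite !sigma_phi => /phi_inj/addrI.
by apply/funext=> x; have [w ->] := phi_surj x; rewrite !sigma_phi e.
Qed.

Lemma card_Ret1 :
  ([set: Ret S]%classic #= `I_1)%card <-> forall u v, f u = f v.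
Proof.
rewrite card_setT1P; last exact: sol_inhabited.
split=> [eqR u v|eqf a b]; first by apply/sigma_phi_eq/ret_classP.
have [x ->] := ret_class_surj a; have [y ->] := ret_class_surj b.
apply/ret_classP; have [u ->] := phi_surj x; have [v ->] := phi_surj y.
exact/sigma_phi_eq.
Qed.

(** The hypothesis says that the left multiplications of Ret S coincide. *)
Lemma card_Ret2 :
  (forall u v w, f (w + f u) = f (w + f v)) ->
  ([set: Ret (Ret S)]%classic #= `I_1)%card.
Proof.
move=> eqf; apply/card_setT1P => [|a b]; first exact: sol_inhabited.
have [a' ->] := ret_class_surj a; have [b' ->] := ret_class_surj b.
apply/ret_classP/funext => c.
have [x ->] := ret_class_surj a'; have [y ->] := ret_class_surj b'.
have [z ->] := ret_class_surj c; rewrite !sigma_ret.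
apply/ret_classP; have [u ->] := phi_surj x; have [v ->] := phi_surj y.
by have [w ->] := phi_surj z; rewrite !sigma_phi; apply/sigma_phi_eq.
Qed.

Lemma is_mpl2 :
  (exists u v, f u <> f v) -> (forall u v w, f (w + f u) = f (w + f v)) ->
  is_mpl S 2.
Proof.
move=> [u [v neq]] /card_Ret2 R2; split=> // [[|[|m]]] //.
  move=> /(card_setT1P (sol_inhabited S)) eqS.
  by case: neq; congr f; apply: phi_inj.
by move=> /card_Ret1 eqf; case: neq.
Qed.

End Coordinates.

Section ConstantDisplacement.

Variables (U : finZmodType) (f : U -> U).
Hypothesis f_const : forall u v, f u = f v.
Hypothesis f_gen : <<[set f x | x : U]>>%g = [set: U].

(** T is the translation by - f 0, and f 0 generates U. *)
Lemma card_dvd_diag_order_const e : iter e (diag f) =1 id -> #|U| %| e.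
Proof.
move=> diag_e; have cycf : [set: U] = <[f 0%R]>%g.
  rewrite -f_gen; congr <<_>>%g; apply/setP=> u; rewrite inE.
  by apply/imsetP/eqP=> [[v _ ->]|->]; [exact: f_const | exists 0%R].
rewrite -cardsT cycf -orderE order_dvdn FinRing.zmodXgE.
have iterE : iter e (diag f) 0%R = (- (f 0 *+ e))%R.
  elim: (e) => [|m IH] /=; first by rewrite mulr0n oppr0.
  by rewrite IH /diag (f_const _ 0%R) mulrSr opprD.
by rewrite -oppr_eq0 -iterE diag_e.
Qed.

End ConstantDisplacement.

(** * Order four *)

Section OrderFour.

(** The subtraction of 'I_4 as it computes on representatives. *)
Definition sub4 a b := (a + (4 - b) %% 4) %% 4.

(** Maps from 'I_4 to itself are encoded by the words of their four values, so
    that the 256 cases can be run through by computation. *)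
Definition cycle_set4 F := all (fun x => all (fun y =>
  (F x + F (sub4 y (F x))) %% 4 == (F y + F (sub4 x (F y))) %% 4)
  (iota 0 4)) (iota 0 4).

(** The first half says that T^2 = 1, the second one that the left
    multiplications of Ret S all coincide. *)
Definition level_two4 F :=
  all (fun x => sub4 (sub4 x (F x)) (F (sub4 x (F x))) == x) (iota 0 4) &&
  all (fun x => all (fun y => all (fun z =>
    F ((z + F x) %% 4) == F ((z + F y) %% 4)) (iota 0 4)) (iota 0 4))
    (iota 0 4).

Definition words4 : seq (seq nat) :=
  [seq x :: s | x <- iota 0 4, s <-
  [seq x :: s | x <- iota 0 4, s <-
  [seq x :: s | x <- iota 0 4, s <-
  [seq [:: x] | x <- iota 0 4]]]].

Lemma words4_check :
  all (fun s => [&& cycle_set4 (nth 0 s), has odd s & ~~ constant s] ==>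
                level_two4 (nth 0 s)) words4.
Proof. by vm_compute. Qed.

Variable f : 'I_4 -> 'I_4.
Hypothesis f_cycle : forall x y, (f x + f (y - f x) = f y + f (x - f y))%R.
Hypothesis f_gen : <<[set f x | x : 'I_4]>>%g = [set: 'I_4].

(** As the values of f generate Z/4, one of them is odd, so the enumeration of
    the words applies. *)
Lemma order4_nonconst :
  (exists u v, f u <> f v) ->
  iter 2 (diag f) =1 id /\ (forall u v w, f (w + f u)%R = f (w + f v)%R).
Proof.
case=> u0 [v0 neq].
pose s := [seq nat_of_ord (f (inord i)) | i <- iota 0 4].
have sE (x : 'I_4) : nth 0 s x = f x.
  by rewrite (nth_map 0) ?size_iota // nth_iota // add0n inord_val.
have all4 (P : pred nat) : all P (iota 0 4) <-> forall x : 'I_4, P x.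
  split=> [/allP allP x|PI]; first by apply: allP; rewrite mem_iota /=.
  by apply/allP=> i; rewrite mem_iota /= => i4; apply: (PI (Ordinal i4)).
have s_in : s \in words4.
  have f_in i : nat_of_ord (f i) \in iota 0 4 by rewrite mem_iota /=.
  do 3!(apply: (allpairs_f cons); first exact: f_in).
  by apply: map_f.
have cyc : cycle_set4 (nth 0 s).
  apply/all4=> x; apply/all4=> y; apply/eqP.
  by have := congr1 val (f_cycle x y); rewrite /= -!sE /= -!sE.
have odd_s : has odd s.
  apply: contraT => /hasPn even_s.
  have even_f x : ~~ odd (f x).
    by rewrite -sE even_s // mem_nth // size_map size_iota ltn_ord.
  have gE : group_set [set x : 'I_4 | ~~ odd x].
    apply/group_setP; split=> [|x y]; first by rewrite inE.
    rewrite !inE => ex ey.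
    rewrite -[nat_of_ord _]/((x + y) %% 4) odd_mod // oddD.
    by rewrite (negPf ex) (negPf ey).
  have: (1%R : 'I_4) \in [set: 'I_4] by rewrite inE.
  have sub : <<[set f x | x : 'I_4]>>%g \subset Group gE.
    by rewrite gen_subG; apply/subsetP=> _ /imsetP[x _ ->]; rewrite inE.
  by rewrite -f_gen => /(subsetP sub); rewrite inE.
have nconst_s : ~~ constant s.
  apply/negP=> /(constantP 0)[c sc]; apply: neq; apply/val_inj.
  by rewrite -[LHS]sE -[RHS]sE sc !nth_nseq size_map size_iota !ltn_ord.
have /andP[/all4 diag2 /all4 swap] : level_two4 (nth 0 s).
  by apply: (implyP (allP words4_check s s_in)); rewrite cyc odd_s.
split=> [x|u v w].
  apply/val_inj; rewrite /diag /= -!sE /= -!sE /=.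
  exact/eqP/diag2.
apply/val_inj; have /all4/(_ v)/all4/(_ w)/eqP := swap u.
by rewrite /= -!sE /= -!sE.
Qed.

End OrderFour.

(** * The Dehornoy class *)

Local Open Scope classical_set_scope.
Local Open Scope card_scope.

Theorem proposition5p14 (S : solution) (p k d : nat) :
  indecomposable S ->
  prime p ->
  perm_cyclic (permutation_group S) ->
  permutation_group S #= `I_(p ^ k) ->
  is_dehornoy_class S d ->
  (~ ([set: S] #= `I_4 /\ is_mpl S 2) -> [set: S] #= `I_d) /\
  ([set: S] #= `I_4 /\ is_mpl S 2 -> d = 2).
Proof.
move=> indS p_pr cycS cardG [d_gt0 triv_d min_d].
have [n oN] : exists n, (p ^ k = n.+1)%N.
  by exists (p ^ k).-1; rewrite prednK // expn_gt0 prime_gt0.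
rewrite oN in cardG.
have [phi [f [bphi sphi f_gen]]] := cyclic_coordinates indS cycS cardG.
have cardS := card_bijective bphi.
have f_cyc := coord_cycle bphi sphi.
have triv e := Omega_trivialP bphi sphi e.
have dinj := coord_diag_inj bphi sphi.
have dN : n.+1 %| d -> d = n.+1.
  move=> Nd; apply/eqP; rewrite eqn_leq (dvdn_leq d_gt0 Nd) andbT.
  apply: min_d => //; apply/triv => u.
  by have := iter_card_diag f_cyc f_gen dinj u; rewrite card_ord.
have cycU : cyclic [set: 'I_n.+1]%SET.
  by apply/cyclicP; exists Zp1; exact: Zp_cycle.
have [const_f|nconst_f] := pselect (forall u v, f u = f v).
  have -> : d = n.+1.
    apply: dN; rewrite -[n.+1]card_ord.
    by apply: (card_dvd_diag_order_const const_f f_gen); exact/triv.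
  split=> // -[_ [_ min2]].
  by have := min2 1 ((card_Ret1 bphi sphi).2 const_f).
have {}nconst_f : exists u v, f u <> f v.
  apply: contrapT => nex; apply: nconst_f => u v; apply: contrapT => neq.
  by apply: nex; exists u, v.
have [n3|n_neq3] := eqVneq n 3; last first.
  have -> : d = n.+1.
    apply: dN; rewrite -[n.+1]card_ord.
    apply: (card_dvd_diag_order (k := k) f_cyc f_gen dinj p_pr) => //.
    - by rewrite card_ord oN.
    - by rewrite card_ord.
    - exact/triv.
  split=> // -[card4 _]; case/eqP: n_neq3.
  have /card_eq_II[//] : `I_n.+1 #= `I_4.
  exact: card_eq_trans (card_esym cardS) card4.
subst n; have [diag2 swap] := order4_nonconst f_cyc f_gen nconst_f.
have mpl2 := is_mpl2 bphi sphi nconst_f swap.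
split=> [|_]; first by case.
have : d <= 2 by apply: min_d => //; exact/triv.
case: d d_gt0 triv_d {min_d dN} => [|[|[|]]] // _ /triv diag1 _.
have f0 u : f u = 0%R.
  have := diag1 u; rewrite /= /diag => /(canRL (subrK _)).
  by rewrite -{1}[u]addr0 => /addrI.
by case: nconst_f => u [v []]; rewrite !f0.
Qed.
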